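(* Let $\gamma$ be a constant. Consider the online multi-commodity flow problem described in the context, and assume that $1\le b_{\min}\le b_{\max}\le O(n^\gamma)$, $1\le c_{\min}\le c_{\max}\le O(n^\gamma)$ and $1\le d_{\min}$, where $b_{\min},b_{\max}$ are the minimum and maximum benefits of the requests, $c_{\min},c_{\max}$ the minimum and maximum edge capacities, and $d_{\min}$ the minimum demand. Then the algorithm $\mathrm{ALG}$, run with the path-pruning min-cost-flow oracle and parameters $\lambda=\mu=2$, $\varepsilon=\frac{1}{2m^2}$, is a non-preemptive, monotone, online algorithm that computes an all-or-nothing multi-commodity flow that is $(O(1),O(\log n))$-competitive.
   Context: Network: a directed graph $G=(V,E)$ with $n=|V|$, $m=|E|$, and edge capacities $c_e\ge 1$. Requests $r_j=(s_j,t_j,d_j,b_j)$, $j=1,2,\dots$, arrive online one by one ($s_j,t_j\in V$ source and target, demand $d_j\ge1$, benefit $b_j\ge 1$); nothing is known about $r_j$ before it arrives. The output is a multi-commodity flow $F=(f_1,f_2,\dots)$ where $f_j$ is a flow from $s_j$ to $t_j$ of value $|f_j|$; $F^{(j)}(e)=\sum_{k\le j}f_k(e)$. $F$ fully serves $r_j$ if $|f_j|=d_j$, rejects it if $|f_j|=0$, and is all-or-nothing if every request is fully served or rejected. $\mathrm{benefit}_j(F)=\sum\{b_i: i\le j,\ r_i \text{ fully served by } F^{(j)}\}$. $F^*$ denotes an optimal offline all-or-nothing multi-commodity flow (respecting capacities: $\sum_k f^*_k(e)\le c_e$) maximizing the total benefit. $F$ is $(\alpha,\beta)$-competitive if for every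 $j$: $\mathrm{benefit}_j(F)\ge \frac1\alpha\mathrm{benefit}_j(F^* )$ and $F^{(j)}(e)\le\beta c_e$ for all $e\in E$. An online algorithm is monotone if flow is never retracted, and non-preemptive if the flow of a fully served request is never retracted. For request $r_k$ and $\mu>0$, $\Pi_k(\mu)$ is the set of unit flows $f$ from $s_k$ to $t_k$ in $G$ with $f(e)\le \mu c_e/d_k$ for all $e$; $\Pi_k=\Pi_k(1)$; $r_k$ is feasible if $\Pi_k\neq\emptyset$. For $w(f)=\sum_e f(e)$, and costs $x^{(j-1)}_e$ (value of variable $x_e$ after request $r_{j-1}$ was processed), $\mathrm{cost}_j(f)=\sum_e x^{(j-1)}_e f(e)$. Algorithm $\mathrm{ALG}$ (with an oracle and parameters $\lambda,\mu,\varepsilon$): initialize $x_e=0$ for all $e$, $z=0$, $F=0$. On arrival of $r_j$: (1) if $\Pi_j=\emptyset$, reject $r_j$. (2) Otherwise let $f_j$ be the unit flow from $s_j$ to $t_j$ returned by the oracle on input $r_j$, edge capacities $c_e/d_j$ and edge costs $x^{(j-1)}$. (3) If $d_j\cdot\mathrm{cost}_j(f_j)<\lambda b_j$, accept: set $F\leftarrow F+d_j f_j$, $z_j\leftarrow \frac{b_j}{d_j}-\frac{\mathrm{cost}_j(f_j)}{\max\{\lambda,\mu\}}$, and for every $e$ with $f_j(e)>0$ let $L_j(e)=\frac{d_j f_j(e)}{\max\{\lambda,\mu\}c_e}$ and update $x_e\leftarrow x_e 2^{L_j(e)}+\frac{1}{d_j w(f_j)}(2^{L_j(e)}-1)$.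 (4) Otherwise reject $r_j$. Path-pruning min-cost-flow oracle (for a feasible $r_j$): let $f$ be a minimum-cost flow in $\Pi_j$ w.r.t. $\mathrm{cost}_j$; decompose $f$ into at most $m$ flow paths $f_1,\dots,f_m$; remove every flow path with $|f_\ell|<\frac{1}{2m^2}$; let $g$ be the total removed flow; scale each remaining path by $f_\ell\leftarrow f_\ell\cdot(1+\frac{|g|}{|f|-|g|})$; output the sum of the remaining scaled paths. *)

(* Defs.v *)
From mathcomp Require Import all_boot all_order all_algebra.
From mathcomp Require Import boolp classical_sets reals exp.
Set Implicit Arguments.
Unset Strict Implicit.
Unset Printing Implicit Defensive.
Import Order.TTheory GRing.Theory Num.Theory.
Local Open Scope classical_set_scope.
Local Open Scope ring_scope.

(* [edge_inj] says that edges are ordered pairs of vertices (no parallel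
   edges); this is what makes m <= n ^ 2. *)
Record network (R : realType) := Network {
  vertex : finType;
  edge : finType;
  esrc : edge -> vertex;
  edst : edge -> vertex;
  edge_inj : injective (fun e => (esrc e, edst e));
  cap : edge -> R }.

Record request (R : realType) (G : network R) := Request {
  source : vertex G;
  target : vertex G;
  demand : R;
  benefit : R }.

Definition flow (R : realType) (G : network R) := {ffun edge G -> R}.

Section Flows.
Variables (R : realType) (G : network R).
Implicit Types (f x : flow G) (r : request G).

Definition excess f (v : vertex G) : R :=
  \sum_(e | esrc e == v) f e - \sum_(e | edst e == v) f e.

Definition is_flow (s t : vertex G) f :=
  (forall e, 0 <= f e) /\ (forall v, v != s -> v != t -> excess f v = 0).

(* The value |f| of a flow f from s to t. When s = t, conservation forces it
   to be 0, so that a request with s = t and positive demand is infeasible. *)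
Definition value (s : vertex G) f : R := excess f s.

Definition Pi r (mu : R) : set (flow G) :=
  [set f | [/\ is_flow (source r) (target r) f,
               value (source r) f = 1
             & forall e, f e <= mu * (cap e / demand r)]].

Definition feasible r := Pi r 1 !=set0.

Definition weight f : R := \sum_e f e.

Definition cost x f : R := \sum_e x e * f e.

End Flows.

Section PathPruningOracle.
Variables (R : realType) (G : network R).
Implicit Types (f x : flow G) (r : request G).

Fixpoint walk (s : vertex G) (p : seq (edge G)) (t : vertex G) : bool :=
  if p is e :: p' then (esrc e == s) && walk (edst e) p' t else s == t.

Definition simple_path (s t : vertex G) (p : seq (edge G)) : bool :=
  walk s p t && uniq (s :: [seq edst e | e <- p]).

(* A flow path is a pair (p, a): the flow sending the amount a along p.
   [path_sum P] is the sum of the flow paths in P. *)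
Definition path_sum (P : seq (seq (edge G) * R)) : flow G :=
  [ffun e => \sum_(q <- P) (if e \in q.1 then q.2 else 0)].

Definition path_decomposition (s t : vertex G) f
    (P : seq (seq (edge G) * R)) :=
  [/\ (size P <= #|edge G|)%N,
      all (fun q => simple_path s t q.1 && (0 <= q.2)) P
    & f = path_sum P].

Definition min_cost_flow r x f :=
  Pi r 1 f /\ (forall f', Pi r 1 f' -> cost x f <= cost x f').

Definition prune (eps : R) (s : vertex G) f (P : seq (seq (edge G) * R)) :
    flow G :=
  let g := path_sum [seq q <- P | q.2 < eps] in
  let scale := 1 + value s g / (value s f - value s g) in
  path_sum [seq (q.1, q.2 * scale) | q <- P & eps <= q.2].

Definition oracle := request G -> flow G -> flow G.

(* The minimum-cost flow and its decomposition are arbitrary. A minimum-cost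
   flow that is not a sum of paths (because of zero-cost cycles) is not
   eligible; deleting its cycles gives an eligible one. Costs are required to
   be nonnegative since otherwise there may be no eligible one at all. *)
Definition path_pruning_oracle (eps : R) (orc : oracle) :=
  forall r x, feasible r -> (forall e, 0 <= x e) ->
  exists f P, [/\ min_cost_flow r x f,
                  path_decomposition (source r) (target r) f P
                & orc r x = prune eps (source r) f P].

End PathPruningOracle.

Section Algorithm.
Variables (R : realType) (G : network R).

(* [A rs j k] is the flow held for the k-th request of rs (counting from 0)
   once the first j requests of rs have been processed. An algorithm receives
   the whole input rs; not looking ahead is the property [online]. *)
Definition algorithm := seq (request G) -> nat -> nat -> flow G.

Record state := State {
  xvar : flow G;
  zvar : seq R;
  flows : seq (flow G) }.

Definition init_state := State 0 [::] [::].

Definition reject (st : state) :=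
  State (xvar st) (rcons (zvar st) 0) (rcons (flows st) 0).

Definition accept (lambda mu : R) (st : state) (r : request G) (f : flow G) :=
  let x := xvar st in
  let L e := demand r * f e / (Num.max lambda mu * cap e) in
  State
    [ffun e => if 0 < f e then
                 x e * 2 `^ L e
                 + 1 / (demand r * weight f) * (2 `^ L e - 1)
               else x e]
    (rcons (zvar st)
       (benefit r / demand r - cost x f / Num.max lambda mu))
    (rcons (flows st) [ffun e => demand r * f e]).

Definition step (orc : oracle G) (lambda mu : R) (st : state)
    (r : request G) : state :=
  if `[< feasible r >] then
    let f := orc r (xvar st) in
    if demand r * cost (xvar st) f < lambda * benefit r
    then accept lambda mu st r f else reject st
  else reject st.

Definition ALG (orc : oracle G) (lambda mu : R) : algorithm :=
  fun rs j k =>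
    nth 0 (flows (foldl (step orc lambda mu) init_state (take j rs))) k.

End Algorithm.

Section Properties.
Variables (R : realType) (G : network R).
Implicit Types (rs : seq (request G)) (F : nat -> flow G).

Definition req rs (i : 'I_(size rs)) : request G := tnth (in_tuple rs) i.

Definition fully_serves F rs (i : 'I_(size rs)) : bool :=
  value (source (req i)) (F i) == demand (req i).

Definition rejects F rs (i : 'I_(size rs)) : bool :=
  value (source (req i)) (F i) == 0.

Definition load F (j : nat) (e : edge G) : R := \sum_(k < j) F k e.

Definition total_benefit rs F (j : nat) : R :=
  \sum_(i < size rs | (i < j)%N && fully_serves F i) benefit (req i).

Definition multiflow rs F (j : nat) :=
  forall i : 'I_(size rs), (i < j)%N ->
    is_flow (source (req i)) (target (req i)) (F i).

Definition all_or_nothing rs F (j : nat) :=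
  forall i : 'I_(size rs), (i < j)%N -> fully_serves F i || rejects F i.

Definition offline_solution rs F :=
  [/\ multiflow rs F (size rs), all_or_nothing rs F (size rs)
    & forall e, load F (size rs) e <= cap e].

Definition offline_optimum rs F :=
  offline_solution rs F /\
  (forall F', offline_solution rs F' ->
     total_benefit rs F' (size rs) <= total_benefit rs F (size rs)).

Definition online (A : algorithm G) :=
  forall rs rs' j, (j <= size rs)%N -> (j <= size rs')%N ->
    take j rs = take j rs' -> A rs j = A rs' j.

Definition monotone (A : algorithm G) rs :=
  forall i j k e, (i <= j <= size rs)%N -> A rs i k e <= A rs j k e.

Definition non_preemptive (A : algorithm G) rs :=
  forall (k : 'I_(size rs)) i j e, (k < i)%N -> (i <= j <= size rs)%N ->
    fully_serves (A rs i) k -> A rs i k e <= A rs j k e.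

Definition competitive (A : algorithm G) rs (alpha beta : R) :=
  (forall Fopt, offline_optimum rs Fopt -> forall j, (j <= size rs)%N ->
     1 / alpha * total_benefit rs Fopt j <= total_benefit rs (A rs j) j) /\
  (forall j e, (j <= size rs)%N -> load (A rs j) j e <= beta * cap e).

End Properties.

(* Main.v *)
Require Import Defs.
From mathcomp Require Import all_boot all_order all_algebra.
From mathcomp Require Import boolp classical_sets reals exp.
From mathcomp Require Import ring lra.
Set Implicit Arguments.
Unset Strict Implicit.
Unset Printing Implicit Defensive.
Import Order.TTheory GRing.Theory Num.Theory.
Local Open Scope ring_scope.

(* Primal-dual analysis.  Pruning a decomposition of a unit flow into at most m
   paths discards at most 1/2 unit, so the oracle returns a unit flow that is
   2-approximate in cost and in capacity and whose positive entries are at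
   least eps.  Accepting r_j raises the potential sum_e c_e x_e by at most
   d_j cost(f_j) / 2 + 1/2, so potential plus dual value grows by at most
   3/2 b_j, while 2-optimality of f_j makes the dual constraint of every served
   offline request hold; weak duality gives the ratio 3/2.  For the loads, the
   update multiplies x_e + a by 2 ^ L_j(e) for every a <= 1 / (d_j w(f_j)), so
   x_e is exponential in the relative load, while an edge can only be used when
   x_e <= 2 b_j / eps: this polynomial bound makes the load logarithmic. *)

(** * Real powers and logarithms *)

Lemma two_powR_le_1Dx (R : realType) (L : R) :
  0 <= L <= 1 -> 2 `^ L <= 1 + L.
Proof.
case/andP=> L0 L1.
have [->|Lneq0] := eqVneq L 0; first by rewrite powRr0 addr0.
have [->|Lneq1] := eqVneq L 1; first by rewrite powRr1 //; lra.
have Lgt0 : 0 < L by rewrite lt0r Lneq0.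
have Llt1 : 0 < 1 - L by rewrite subr_gt0 lt_neqAle Lneq1.
(* Young's inequality with exponents 1 / L and 1 / (1 - L) *)
have := @conjugate_powR R (2 `^ L) 1 L^-1 (1 - L)^-1 (powR_ge0 _ _) ler01.
rewrite !invr_gt0 !invrK powR1 -powRrM mulfV // powRr1 // mulr1 mul1r.
by move=> /(_ Lgt0 Llt1) H; apply: le_trans (H _) _; lra.
Qed.

(** As [n] is at least 2, [ln K] is at most [ln K / ln 2 * ln n], so the constant [K] is absorbed
    into the factor of [ln n]. *)
Lemma ln_le_of_powR_bound (R : realType) (K gamma L n : R) :
  1 <= K -> 0 <= gamma -> 2 <= n -> 2 `^ L <= K * n `^ gamma ->
  L <= (ln K / ln 2 + gamma) / ln 2 * ln n.
Proof.
move=> K1 g0 n2 HL.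
have ln2 : 0 < ln 2 :> R by apply: ln_gt0; lra.
have lnn : ln 2 <= ln n :> R by rewrite ler_ln // posrE; lra.
have lnK : 0 <= ln K by apply: ln_ge0.
have n0 : 0 < n `^ gamma by apply: powR_gt0; lra.
have : ln (2 `^ L) <= ln (K * n `^ gamma).
  by rewrite ler_ln // posrE ?powR_gt0 ?mulr_gt0 //; lra.
rewrite lnM ?posrE //; last lra.
rewrite !ln_powR => H.
have H2 : ln K <= ln K / ln 2 * ln n.
  by rewrite mulrAC ler_pdivlMr // ler_wpM2l.
rewrite mulrAC ler_pdivlMr //; lra.
Qed.

(** * Excesses of flows and sums of flow paths *)

Section Flows.
Variables (R : realType) (G : network R).
Implicit Types (f x : flow G) (r : request G) (s t v : vertex G).
Implicit Types (P : seq (seq (edge G) * R)).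

Lemma big_edges_cons (c : pred (edge G)) (a : R) e0 (p : seq (edge G)) :
  e0 \notin p ->
  \sum_(e | c e) (if e \in e0 :: p then a else 0) =
  (if c e0 then a else 0) + \sum_(e | c e) (if e \in p then a else 0).
Proof.
move=> e0p; rewrite (eq_bigr (fun e => (if e == e0 then a else 0) +
    (if e \in p then a else 0))); last first.
  move=> e _; rewrite inE; case: eqVneq => [->|]; last by rewrite add0r.
  by rewrite (negPf e0p) addr0.
rewrite big_split /=; congr (_ + _).
rewrite -big_mkcondr /=; case: ifP => ce0.
  by rewrite (big_pred1 e0) // => e /=; case: eqVneq => [->|];
    rewrite ?ce0 ?andbF.
by rewrite big_pred0 // => e; case: eqVneq => [->|]; rewrite ?ce0 ?andbF.
Qed.

(** The sum telescopes: the first edge contributes its tail minus its head, and the rest of the path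
    starts at that head. Distinct vertices make the edges distinct ([map_uniq]). *)
Lemma path_excess s t (p : seq (edge G)) (a : R) v :
  simple_path s t p ->
  \sum_(e | esrc e == v) (if e \in p then a else 0)
  - \sum_(e | edst e == v) (if e \in p then a else 0)
  = a * ((s == v)%:R - (t == v)%:R).
Proof.
case/andP=> + /= /andP[_ /map_uniq]; elim: p s => [|e0 p IH] s /=.
  move=> /eqP-> _; rewrite !big1 => *; rewrite ?in_nil //; ring.
case/andP=> /eqP <- wp /andP[e0p up].
rewrite !big_edges_cons // opprD addrACA (IH _ wp up).
by case: (esrc e0 == v); case: (edst e0 == v) => /=; ring.
Qed.

Lemma excess_path_sum s t P v : all (fun q => simple_path s t q.1) P ->
  excess (path_sum P) v = (\sum_(q <- P) q.2) * ((s == v)%:R - (t == v)%:R).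
Proof.
move=> /allP HP; rewrite /excess.
under eq_bigr do rewrite ffunE.
under [X in _ - X]eq_bigr do rewrite ffunE.
rewrite exchange_big [X in _ - X]exchange_big /= -sumrB mulr_suml.
by rewrite !big_seq; apply: eq_bigr => q /HP /path_excess ->.
Qed.

Lemma excessZ (a : R) f v : excess [ffun e => a * f e] v = a * excess f v.
Proof.
rewrite /excess mulrBr !mulr_sumr.
by congr (_ - _); apply: eq_bigr => e _; rewrite ffunE.
Qed.

(** Every edge counts once at its tail and once, with opposite sign, at its head. *)
Lemma sum_excess f : \sum_v excess f v = 0.
Proof.
rewrite /excess sumrB.
rewrite (exchange_big_dep xpredT) //= [X in _ - X](exchange_big_dep xpredT) //=.
rewrite [X in X - _](eq_bigr f); last first.
  by move=> e _; rewrite (big_pred1 _ (fun v => eq_sym _ v)).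
by rewrite [X in _ - X](eq_bigr f) ?subrr // => e _;
  rewrite (big_pred1 _ (fun v => eq_sym _ v)).
Qed.

(** Otherwise conservation elsewhere and [sum_excess] would force the value 0 instead of 1. *)
Lemma feasible_neq r : feasible r -> source r != target r.
Proof.
case=> f [[_ Hf] Hv _]; apply/negP => /eqP st.
have := sum_excess f; rewrite (bigD1 (source r)) //= big1 ?addr0.
  by rewrite -/(value _ f) Hv => /eqP; rewrite oner_eq0.
by move=> v vs; apply: Hf; rewrite // -st.
Qed.

Lemma value_le_weight s f : (forall e, 0 <= f e) -> value s f <= weight f.
Proof.
move=> f0; rewrite /value /excess /weight.
rewrite (bigID (fun e => esrc e == s) xpredT) /=.
rewrite lerD // (@le_trans _ _ 0) // ?oppr_le0; exact: sumr_ge0.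
Qed.

Lemma path_sum_ge0 P e : all (fun q => 0 <= q.2) P -> 0 <= path_sum P e.
Proof.
move=> /allP HP; rewrite ffunE big_seq; apply: sumr_ge0 => q /HP.
by case: ifP.
Qed.

Lemma path_sum_filter_le (c : pred (seq (edge G) * R)) P e :
  all (fun q => 0 <= q.2) P -> path_sum (filter c P) e <= path_sum P e.
Proof.
move=> /allP HP; rewrite !ffunE big_filter [leRHS](bigID c) /= lerDl big_seq_cond.
by apply: sumr_ge0 => q /andP[/HP]; case: ifP.
Qed.

Lemma path_sumZ (a : R) P :
  path_sum [seq (q.1, q.2 * a) | q <- P] = [ffun e => a * path_sum P e].
Proof.
apply/ffunP => e; rewrite !ffunE big_map mulr_sumr; apply: eq_bigr => q _ /=.
by case: ifP => _; rewrite ?mulr0 // mulrC.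
Qed.

(** A positive sum needs a path through [e], which alone carries at least [b]. *)
Lemma path_sum_gt0_ge (b : R) P e :
  all (fun q => (0 <= q.2) && (b <= q.2)) P -> 0 < path_sum P e ->
  b <= path_sum P e.
Proof.
rewrite ffunE; elim: P => [|q P IH]; first by rewrite big_nil ltxx.
rewrite big_cons /= => /andP[/andP[q0 bq] HP].
case: ifP => _; last by rewrite add0r; exact: IH.
move=> _; apply: (le_trans bq); rewrite lerDl.
have := @path_sum_ge0 P e; rewrite ffunE; apply.
by apply: sub_all HP => ? /andP[].
Qed.

End Flows.

(** * Guarantees of the path-pruning oracle *)

Section Oracle.
Variables (R : realType) (G : network R).
Implicit Types (f x : flow G) (r : request G).
Implicit Types (P : seq (seq (edge G) * R)).

Let m : R := #|edge G|%:R.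
Let eps : R := 1 / (2 * m ^+ 2).

(* The discarded paths carry at most m * eps <= 1 / 2 units in total, so the
   rescaling factor is at most 2. *)
Lemma prune_spec (s t : vertex G) f P : s != t ->
  value s f = 1 -> path_decomposition s t f P ->
  [/\ is_flow s t (prune eps s f P),
      value s (prune eps s f P) = 1,
      forall e, prune eps s f P e <= 2 * f e
    & forall e, 0 < prune eps s f P e -> eps <= prune eps s f P e].
Proof.
move=> st vf [szP aP fP].
have aP1 : all (fun q => simple_path s t q.1) P.
  by apply: sub_all aP => q /andP[].
have aP2 : all (fun q => 0 <= q.2) P by apply: sub_all aP => q /andP[].
have allf T (c d : pred T) Q : all c Q -> all c (filter d Q).
  by move=> H; rewrite all_filter; apply: sub_all H => q /= ->; rewrite implybT.
have valE Q : all (fun q => simple_path s t q.1) Q ->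
    value s (path_sum Q) = \sum_(q <- Q) q.2.
  move=> aQ; rewrite /value (excess_path_sum _ aQ) eqxx eq_sym (negPf st).
  by rewrite subr0 mulr1.
set S := [seq q <- P | q.2 < eps]; set B := [seq q <- P | eps <= q.2].
have m1 : 1 <= m.
  rewrite ler1n lt0n; apply/negP => /eqP m0; move: vf.
  by rewrite /value /excess !big1 ?subr0 => [/eqP|e _|e _];
    [rewrite eq_sym oner_eq0 | have := card0_eq m0 e; rewrite inE
    | have := card0_eq m0 e; rewrite inE].
have SB : \sum_(q <- S) q.2 + \sum_(q <- B) q.2 = 1.
  move: vf; rewrite fP (valE _ aP1) => <-.
  rewrite !big_filter [RHS](bigID (fun q => q.2 < eps)) /=; congr (_ + _).
  by apply: eq_bigl => q; rewrite -leNgt.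
have S0 : 0 <= \sum_(q <- S) q.2.
  by rewrite big_filter big_seq_cond; apply: sumr_ge0 => q /andP[/(allP aP2)].
have eps0 : 0 < eps by rewrite /eps divr_gt0 // mulr_gt0 // exprn_gt0; lra.
have S1 : \sum_(q <- S) q.2 <= 1 / 2.
  apply: (@le_trans _ _ (\sum_(q <- P) eps)).
    rewrite big_filter [leRHS](bigID (fun q => q.2 < eps)) /=.
    rewrite -[leLHS]addr0 lerD ?sumr_ge0 //; last by move=> *; exact: ltW.
    by apply: ler_sum => q /ltW.
  rewrite big_const_seq count_predT iter_addr_0 -[leLHS]mulr_natl.
  apply: (@le_trans _ _ (m * eps)); first by rewrite ler_pM2r // ler_nat.
  have -> : m * eps = 1 / 2 / m by rewrite /eps; field; lra.
  by rewrite ler_pdivrMr; lra.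
rewrite /prune -/S -/B vf !(valE _ (allf _ _ _ _ aP1)).
set sS := \sum_(q <- S) q.2 in SB S0 S1 *.
have -> : 1 + sS / (1 - sS) = (1 - sS)^-1 by field; lra.
have k0 : 0 < 1 - sS by lra.
have k1 : 1 <= (1 - sS)^-1 by rewrite invf_ge1 //; lra.
have k2 : (1 - sS)^-1 <= 2 by rewrite invf_ple ?posrE //; lra.
rewrite path_sumZ.
have B0 e : 0 <= path_sum B e by apply: path_sum_ge0; exact: allf.
split.
- split=> [e|v vs vt]; first by rewrite ffunE mulr_ge0 //; lra.
  rewrite excessZ (excess_path_sum _ (allf _ _ _ _ aP1)).
  by rewrite eq_sym (negPf vs) eq_sym (negPf vt) subrr !mulr0.
- rewrite /value excessZ -/(value _ _) (valE _ (allf _ _ _ _ aP1)) -/B.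
  have -> : \sum_(q <- B) q.2 = 1 - sS by rewrite -SB; ring.
  by rewrite mulVf //; lra.
- move=> e; rewrite ffunE; apply: ler_pM => //; first lra.
  by rewrite fP; apply: path_sum_filter_le.
- move=> e; rewrite ffunE => /[dup] H1; rewrite pmulr_rgt0; last lra.
  move=> /(@path_sum_gt0_ge _ _ eps) -/(_ _)/le_trans; apply.
    by rewrite all_filter; apply: sub_all aP2 => q /= ->; apply/implyP => ->.
  by rewrite ler_peMl.
Qed.

(** Pruning at most doubles the minimum-cost flow on each edge; as prices are nonnegative, its cost
    is at most doubled too. *)
Lemma oracle_spec (orc : oracle G) r x :
  path_pruning_oracle eps orc -> feasible r -> (forall e, 0 <= x e) ->
  [/\ Pi r 2 (orc r x),
      forall e, 0 < orc r x e -> eps <= orc r x e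
    & forall h, Pi r 1 h -> cost x (orc r x) <= 2 * cost x h].
Proof.
move=> Horc fr x0; have [f [P [[[ff vf cf] fmin] decP ->]]] := Horc r x fr x0.
have [gf gv g2 geps] := prune_spec (feasible_neq fr) vf decP.
split=> //.
- split=> // e; apply: (le_trans (g2 e)).
  by rewrite ler_pM2l //; have := cf e; rewrite mul1r.
- move=> h /fmin Hh; apply: (@le_trans _ _ (2 * cost x f)); last first.
    by rewrite ler_pM2l.
  rewrite /cost mulr_sumr; apply: ler_sum => e _.
  by rewrite mulrCA; apply: ler_wpM2l.
Qed.

End Oracle.

(** * Primal-dual analysis of a single request *)

Section Step.
Variables (R : realType) (G : network R).
Implicit Types (f x : flow G) (r : request G) (st : state G).

Let m : R := #|edge G|%:R.
Let eps : R := 1 / (2 * m ^+ 2).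

(* The primal-dual analysis never looks at the variable z_j: it is replaced by
   the amount [dual_slack] which the increase of the potential leaves over. *)
Definition potential x : R := \sum_e cap e * x e.

Definition dual_slack x x' r f : R :=
  3 / 2 * (if value (source r) f == demand r then benefit r else 0)
  - (potential x' - potential x).

(* A lower bound on 1 / (d_j w(f_j)) for every flow the oracle can return. *)
Definition unit_price : R := 1 / (2 * \sum_(e : edge G) cap e).

(** The interface between a single request and the run, shared by acceptance and rejection.
    [step_dual] is the dual constraint, [step_load] and [step_bound] squeeze the price from below
    and above, and [step_loop] serves networks with at most one vertex. *)
Record good_step x x' r f : Prop := GoodStep {
  step_flow : is_flow (source r) (target r) f;
  step_value : (value (source r) f == demand r) || (value (source r) f == 0);
  step_loop : source r = target r -> f = 0;
  step_mono : forall e, x e <= x' e;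
  step_slack : 0 <= dual_slack x x' r f;
  step_dual : forall h, Pi r 1 h ->
    benefit r <= demand r * cost x h + dual_slack x x' r f;
  step_load : forall e,
    (x e + unit_price) * 2 `^ (f e / (2 * cap e)) <= x' e + unit_price;
  step_bound : forall e, x' e <= Num.max (x e) (8 * m ^+ 2 * benefit r + 1) }.

(** Rejection leaves the slack at 0, so the current prices alone must satisfy the dual
    constraint. *)
Lemma good_step_reject x r : 0 < demand r ->
  (forall h, Pi r 1 h -> benefit r <= demand r * cost x h) ->
  good_step x x r 0.
Proof.
move=> d0 Hb.
have v0 s : value s (0 : flow G) = 0.
  by rewrite /value /excess !big1 ?subr0 // => e _; rewrite ffunE.
have sl : dual_slack x x r 0 = 0.
  by rewrite /dual_slack v0 eq_sym (gt_eqF d0) mulr0 !subrr.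
split=> //.
- by split=> [e|v _ _]; [rewrite ffunE | rewrite -/(value v 0) v0].
- by rewrite v0 eqxx orbT.
- by rewrite sl.
- by move=> h /Hb; rewrite sl addr0.
- by move=> e; rewrite ffunE mul0r powRr0 mulr1.
- by move=> e; rewrite le_max lexx.
Qed.

Lemma good_step_accept st r f :
  (forall e : edge G, 1 <= cap e) -> 1 <= benefit r -> 1 <= demand r ->
  source r != target r -> (forall e, 0 <= xvar st e) ->
  Pi r 2 f -> (forall e, 0 < f e -> eps <= f e) ->
  (forall h, Pi r 1 h -> cost (xvar st) f <= 2 * cost (xvar st) h) ->
  demand r * cost (xvar st) f < 2 * benefit r ->
  good_step (xvar st) (xvar (accept 2 2 st r f)) r [ffun e => demand r * f e].
Proof.
move=> c1 b1 d1 neq_st x0 [[f0 fc] fv f2] feps fopt fcost.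
set x := xvar st in x0 fopt fcost *; set x' := xvar _.
set d := demand r in d1 f2 fcost *; set b := benefit r in b1 fcost *.
have w1 : 1 <= weight f by rewrite -fv; exact: value_le_weight.
pose L e := d * f e / (2 * cap e).
pose a := 1 / (d * weight f).
have dw1 : 1 <= d * weight f by rewrite mulr_ege1.
have a0 : 0 < a by rewrite /a divr_gt0 //; lra.
have a1 : a <= 1 by rewrite /a ler_pdivrMr; lra.
(* The capacity factor 2 of the oracle matches the 2 in the denominator of [L], so [L e] stays in
   the range of [two_powR_le_1Dx]. *)
have df e : d * f e <= 2 * cap e.
  have := f2 e; rewrite mulrA ler_pdivlMr; last lra.
  by rewrite mulrC.
have L01 e : 0 <= L e <= 1.
  have ce := c1 e; have dfe := df e; have fe := f0 e.
  rewrite /L divr_ge0 ?mulr_ge0 //=; try lra.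
  by rewrite ler_pdivrMr; lra.
have L2 e : 1 <= 2 `^ L e.
  by rewrite -[leLHS](powRr0 2) ler_powR ?ler1n //; case/andP: (L01 e).
(* On [x e + a] the update is plain multiplication; edges with [f e = 0] fit the same formula
   because their exponent is 0. *)
have x'E e : x' e = (x e + a) * 2 `^ L e - a.
  rewrite /x' /= ffunE maxxx -/x -/d -/(L e) -/a.
  case: ifP => [_|]; first by ring.
  rewrite lt0r f0 andbT => /negbFE/eqP fe0.
  by rewrite /L fe0 mulr0 mul0r powRr0; ring.
have mono e : x e <= x' e.
  rewrite x'E; have := ler_peMr (_ : 0 <= x e + a) (L2 e).
  by move=> /(_ (addr_ge0 (x0 e) (ltW a0))); lra.
have vE : value (source r) [ffun e => d * f e] = d.
  by rewrite /value excessZ -/(value _ _) fv mulr1.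
(* 2 ^ L - 1 <= L turns the increase into d cost(f) / 2 + 1 / 2. *)
have pot : potential x' - potential x <= d * cost x f / 2 + 1 / 2.
  rewrite /potential -sumrB.
  (* The terms in [a] add up to [a * d * weight f / 2], which is [1 / 2]. *)
  have -> : d * cost x f / 2 + 1 / 2 = \sum_e (x e + a) * (d * f e / 2).
    under [RHS]eq_bigr do rewrite mulrDl.
    rewrite big_split /=; congr (_ + _).
      rewrite /cost mulr_sumr mulr_suml; apply: eq_bigr => e _; ring.
    rewrite -mulr_sumr -mulr_suml -mulr_sumr -/(weight f) /a.
    by field; apply/andP; split; lra.
  apply: ler_sum => e _; rewrite -mulrBr x'E.
  have -> : cap e * ((x e + a) * 2 `^ L e - a - x e) =
            (x e + a) * (cap e * (2 `^ L e - 1)) by ring.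
  apply: ler_wpM2l; first by rewrite addr_ge0 // ltW.
  have -> : d * f e / 2 = cap e * L e.
    by rewrite /L; field; have := c1 e; lra.
  have ce := c1 e; apply: ler_wpM2l; first lra.
  by have := two_powR_le_1Dx (L01 e); lra.
(* As [b] is at least 1, [3 / 2 * b - 1 / 2] is at least [b]. *)
have sl : b - d * cost x f / 2 <= dual_slack x x' r [ffun e => d * f e].
  by rewrite /dual_slack vE eqxx -/b; lra.
split=> //.
- split=> [e|v vs vt]; first by rewrite ffunE mulr_ge0 //; lra.
  by rewrite excessZ fc // mulr0.
- by rewrite vE eqxx.
- by move/eqP: neq_st.
- by lra.
- move=> h /fopt Hh; apply: (le_trans _ (lerD (lexx _) sl)).
  have : d * cost x f <= d * (2 * cost x h) by rewrite ler_pM2l //; lra.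
  by rewrite -/b -/d; lra.
- move=> e; rewrite ffunE -/(L e) x'E.
  (* Summing [df] over all edges bounds the denominator of [a]. Replacing [a] by the smaller
     [unit_price] weakens the growth law, since the factor is at least 1. *)
  have aA : unit_price <= a.
    have dwS : d * weight f <= 2 * \sum_(i : edge G) cap i.
      by rewrite /weight !mulr_sumr; apply: ler_sum.
    by rewrite /unit_price /a !mul1r lef_pV2 ?posrE //; lra.
  have : 0 <= (a - unit_price) * (2 `^ L e - 1).
    by rewrite mulr_ge0 // subr_ge0.
  lra.
- move=> e; rewrite x'E.
  have : 0 <= f e by []. rewrite le_eqVlt => /orP[/eqP fe0|fe0].
    by rewrite /L -fe0 mulr0 mul0r powRr0 mulr1 addrK le_max lexx.
  rewrite le_max; apply/orP; right.
  have m0 : 0 < m by rewrite ltr0n; apply/card_gt0P; exists e.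
  (* A used edge carries at least [eps], so [x e * eps] is at most the cost of [f], which acceptance
     bounds by [2 * b]. *)
  have xcost : x e * eps <= 2 * b.
    apply: (@le_trans _ _ (cost x f)).
      apply: (@le_trans _ _ (x e * f e)); first by rewrite ler_wpM2l ?feps.
      rewrite /cost (bigD1 e) //= lerDl; apply: sumr_ge0 => i _.
      exact: mulr_ge0.
    apply: ltW (le_lt_trans _ fcost); rewrite ler_peMl //.
    by apply: sumr_ge0 => i _; apply: mulr_ge0.
  have xe : x e <= 4 * m ^+ 2 * b.
    rewrite -(@ler_pM2r _ eps) ?divr_gt0 ?mulr_gt0 ?exprn_gt0 //.
    apply: (le_trans xcost); rewrite le_eqVlt; apply/orP; left; apply/eqP.
    by rewrite /eps; field; lra.
  have [_ Le1] := andP (L01 e).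
  (* Hence [x' e <= 2 * x e + a], which explains the constants 8 and 1 of [step_bound]. *)
  have : (x e + a) * 2 `^ L e <= (x e + a) * 2.
    apply: ler_wpM2l; first by rewrite addr_ge0 // ltW.
    by have := two_powR_le_1Dx (L01 e); lra.
  rewrite -/b; lra.
Qed.

End Step.

(** * The whole run: prefixes, prices and weak duality *)

Section Run.
Variables (R : realType) (G : network R) (orc : oracle G).

Let m : R := #|edge G|%:R.
Let eps : R := 1 / (2 * m ^+ 2).

Hypothesis Horc : path_pruning_oracle eps orc.
Hypothesis cap1 : forall e : edge G, 1 <= cap e.

(** For an infeasible request the dual constraint is vacuous. For one that is too expensive,
    [2 * benefit r] is at most the oracle's scaled cost, hence at most twice that of any [h] in
    [Pi r 1]. *)
Lemma step_good (st : state G) (r : request G) :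
  1 <= benefit r -> 1 <= demand r -> (forall e, 0 <= xvar st e) ->
  exists f, flows (step orc 2 2 st r) = rcons (flows st) f /\
    good_step (xvar st) (xvar (step orc 2 2 st r)) r f.
Proof.
move=> b1 d1 x0; rewrite /step.
have d0 : 0 < demand r by lra.
case: asboolP => [fr|nfr]; last first.
  exists 0; split=> //; apply: good_step_reject => // h Hh.
  by case: nfr; exists h.
have [oPi oeps ocost] := oracle_spec Horc fr x0.
case: ltP => [acc|rej].
  eexists; split; first by [].
  exact: good_step_accept (feasible_neq fr) _ _ _ _ _.
exists 0; split=> //; apply: good_step_reject => // h /ocost Hh.
have : demand r * cost (xvar st) (orc r (xvar st))
       <= demand r * (2 * cost (xvar st) h) by rewrite ler_pM2l.
lra.
Qed.

Variable rs : seq (request G).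
Hypothesis ben1 : forall i : 'I_(size rs), 1 <= benefit (req i).
Hypothesis dem1 : forall i : 'I_(size rs), 1 <= demand (req i).

Let run j := foldl (step orc 2 2) (init_state G) (take j rs).
Let price j := xvar (run j).
Let F k := ALG orc 2 2 rs (size rs) k.

Lemma run_succ (i : 'I_(size rs)) : run i.+1 = step orc 2 2 (run i) (req i).
Proof.
rewrite /run (take_nth (req i)) // -cats1 foldl_cat /=.
by congr step; rewrite [RHS](tnth_nth (req i)).
Qed.

Lemma size_flows_run j : (j <= size rs)%N -> size (flows (run j)) = j.
Proof.
elim: j => [|j IH] lej; first by rewrite /run take0.
rewrite (run_succ (Ordinal lej)) /step.
by case: ifP => _; [case: ifP => _|]; rewrite /= size_rcons IH // ltnW.
Qed.

Lemma price_ge0 j e : (j <= size rs)%N -> 0 <= price j e.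
Proof.
elim: j e => [|j IH] e lej; first by rewrite /price /run take0 ffunE.
pose i := Ordinal lej.
have x0 e' : 0 <= xvar (run i) e' by exact: IH (ltnW lej).
have [f [_ gs]] := step_good (ben1 i) (dem1 i) x0.
rewrite /price (run_succ i); exact: le_trans (x0 e) (step_mono gs e).
Qed.

Lemma flows_run_take j k : (j <= k <= size rs)%N ->
  flows (run j) = take j (flows (run k)).
Proof.
case/andP; elim: k => [|k IH].
  by rewrite leqn0 => /eqP->; rewrite take0 /run take0.
rewrite leq_eqVlt => /orP[/eqP-> lek|jk lek].
  by rewrite take_oversize // size_flows_run.
have [f [Hf _]] := step_good (ben1 (Ordinal lek)) (dem1 (Ordinal lek))
  (fun e => price_ge0 e (ltnW lek)).
rewrite (run_succ (Ordinal lek)) Hf -cats1 takel_cat ?IH //; first exact: ltnW.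
by rewrite size_flows_run // ltnW.
Qed.

(** Flows are only ever appended, so a flow is final once its request is processed, and claims about
    prefixes reduce to the final flows [F]. *)
Lemma ALG_prefix j k : (j <= size rs)%N ->
  ALG orc 2 2 rs j k = if (k < j)%N then F k else 0.
Proof.
move=> lej; rewrite /F /ALG -/(run j) -/(run _).
case: ltnP => [kj|jk]; last by rewrite nth_default // size_flows_run.
have jn : (j <= size rs <= size rs)%N by rewrite lej leqnn.
by rewrite (flows_run_take jn) nth_take.
Qed.

Lemma run_good (i : 'I_(size rs)) :
  good_step (price i) (price i.+1) (req i) (F i).
Proof.
have lti := ltn_ord i.
have [f [Hf gs]] := step_good (ben1 i) (dem1 i)
  (fun e => price_ge0 e (ltnW lti)).
have -> : F i = f; last by rewrite /price run_succ.
have <- : ALG orc 2 2 rs i.+1 i = F i by rewrite ALG_prefix // ltnSn.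
rewrite /ALG -/(run _) run_succ Hf nth_rcons size_flows_run ?ltnn ?eqxx //.
exact: ltnW.
Qed.

Lemma ALG_flow_ge0 k e : 0 <= F k e.
Proof.
have [kn|nk] := ltnP k (size rs).
  by have [] := step_flow (run_good (Ordinal kn)).
by rewrite /F /ALG nth_default ?ffunE // -/(run _) size_flows_run.
Qed.

Lemma ALG_monotone : monotone (ALG orc 2 2) rs.
Proof.
move=> i j k e /andP[ij lej]; rewrite !ALG_prefix //; last exact: leq_trans lej.
case: ltnP => ki; first by rewrite (leq_trans ki ij).
by case: ifP => _; rewrite ffunE // ALG_flow_ge0.
Qed.

Lemma ALG_flow_spec j : (j <= size rs)%N ->
  multiflow rs (ALG orc 2 2 rs j) j /\ all_or_nothing rs (ALG orc 2 2 rs j) j.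
Proof.
move=> lej; split=> i ij; rewrite /fully_serves /rejects ALG_prefix // ij.
  exact: step_flow (run_good i).
exact: step_value (run_good i).
Qed.

Lemma load_ALG j e : (j <= size rs)%N ->
  load (ALG orc 2 2 rs j) j e = \sum_(k < j) F k e.
Proof. by move=> lej; apply: eq_bigr => k _; rewrite ALG_prefix // ltn_ord. Qed.

(** Iterating [step_load] from price 0, the exponents add up to the relative load. *)
Lemma load_price j e : (j <= size rs)%N ->
  unit_price G * 2 `^ ((\sum_(k < j) F k e) / (2 * cap e))
  <= price j e + unit_price G.
Proof.
elim: j => [|j IH] lej.
  by rewrite big_ord0 mul0r powRr0 mulr1 lerDr price_ge0.
rewrite big_ord_recr /= mulrDl powRD ?mulrA; last first.
  by apply/implyP => _; rewrite pnatr_eq0.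
apply: le_trans (step_load (run_good (Ordinal lej)) e).
by apply: ler_wpM2r (IH (ltnW lej)); exact: powR_ge0.
Qed.

(** The bound in [step_bound] is a maximum, not an increment, so it does not accumulate with [j]. *)
Lemma price_bound (b : R) j e : (j <= size rs)%N ->
  (forall i : 'I_(size rs), benefit (req i) <= b) ->
  0 <= b -> price j e <= 8 * m ^+ 2 * b + 1.
Proof.
move=> + bb b0; have mb : 0 <= 8 * m ^+ 2 by rewrite mulr_ge0 // sqr_ge0.
elim: j => [|j IH] lej.
  by rewrite /price /run take0 ffunE addr_ge0 // mulr_ge0.
apply: le_trans (step_bound (run_good (Ordinal lej)) e) _.
rewrite ge_max; apply/andP; split; first exact: IH (ltnW lej).
by rewrite lerD2r; apply: ler_wpM2l.
Qed.

(** Source and target coincide here. The case is separate because [ln n] is then 0 and leaves no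
    room for any load. *)
Lemma ALG_load_trivial j e : (#|vertex G| <= 1)%N -> (j <= size rs)%N ->
  load (ALG orc 2 2 rs j) j e = 0.
Proof.
move=> /card_le1_eqP V1 lej; rewrite load_ALG // big1 // => k _.
have kn := leq_trans (ltn_ord k) lej.
by rewrite (step_loop (run_good (Ordinal kn)) (V1 _ _ isT isT)) ffunE.
Qed.

Lemma prefix_sum_succ (i : 'I_(size rs)) (P : pred 'I_(size rs))
    (g : 'I_(size rs) -> R) :
  \sum_(k < size rs | (k < i.+1)%N && P k) g k =
  \sum_(k < size rs | (k < i)%N && P k) g k + (if P i then g i else 0).
Proof.
rewrite (bigID (fun k => k == i)) /= addrC; congr (_ + _).
  apply: eq_bigl => k; rewrite ltnS.
  have -> : (k < i)%N = (k != i) && (k <= i)%N by rewrite ltn_neqAle.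
  by case: (P k); rewrite ?andbT ?andbF //= andbC.
case: ifP => Pi; [rewrite (big_pred1 i)|rewrite big_pred0] => // k /=.
  by case: eqVneq => [->|]; rewrite ?leqnn ?Pi ?andbF.
by case: eqVneq => [->|]; rewrite ?Pi ?andbF.
Qed.

Lemma eq_total_benefit (F1 F2 : nat -> flow G) j :
  (forall k, (k < j)%N -> F1 k = F2 k) ->
  total_benefit rs F1 j = total_benefit rs F2 j.
Proof.
move=> F12; apply: eq_bigl => i; rewrite /fully_serves.
by case: ltnP => //= ij; rewrite F12.
Qed.

Lemma total_benefit_succ (F1 : nat -> flow G) (i : 'I_(size rs)) :
  total_benefit rs F1 i.+1 = total_benefit rs F1 i
    + (if fully_serves F1 i then benefit (req i) else 0).
Proof. exact: prefix_sum_succ. Qed.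

(* A fully served request of an offline solution, rescaled to a unit flow,
   competes in [Pi (req i) 1]. *)
Lemma served_benefit_le (Fopt : nat -> flow G) (i : 'I_(size rs)) :
  offline_solution rs Fopt -> fully_serves Fopt i ->
  benefit (req i) <= \sum_e price i e * Fopt i e
                     + dual_slack (price i) (price i.+1) (req i) (F i).
Proof.
case=> Fmf _ Fload /eqP served.
have d0 : 0 < demand (req i) by have := dem1 i; lra.
have [f0 fc] := Fmf i (ltn_ord i).
have dn0 : demand (req i) != 0 by rewrite gt_eqF.
pose h : flow G := [ffun e => (demand (req i))^-1 * Fopt i e].
have hPi : Pi (req i) 1 h.
  split.
  - split=> [e|v vs vt]; first by rewrite ffunE mulr_ge0 ?invr_ge0 // ltW.
    by rewrite excessZ fc ?mulr0.
  - by rewrite /value excessZ -/(value _ _) served mulVf.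
  - move=> e; rewrite ffunE mul1r mulrC ler_pM2r ?invr_gt0 //.
    apply: le_trans (Fload e); rewrite /load (bigD1 i) //= lerDl.
    by apply: sumr_ge0 => k _; have [] := Fmf k (ltn_ord k).
have := step_dual (run_good i) hPi.
have -> // : demand (req i) * cost (price i) h = \sum_e price i e * Fopt i e.
rewrite /cost mulr_sumr; apply: eq_bigr => e _; rewrite ffunE.
by field.
Qed.

(** Induction on [j]: a request served offline is paid for by its flow at current prices plus the
    slack; otherwise the slack is merely nonnegative. Prices only grow, so later ones may replace
    current ones, and the slacks telescope to the last summand. *)
Lemma offline_benefit_bound (Fopt : nat -> flow G) j :
  offline_solution rs Fopt -> (j <= size rs)%N ->
  total_benefit rs Fopt j <=
    \sum_e price j e * (\sum_(k < j) Fopt k e)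
    + (3 / 2 * total_benefit rs F j - potential (price j)).
Proof.
move=> sol; have [Fmf Faon Fload] := sol.
have opt0 k e : (k < size rs)%N -> 0 <= Fopt k e.
  by move=> kn; have [] := Fmf (Ordinal kn) kn.
elim: j => [|j IH] lej.
  have tb0 F1 : total_benefit rs F1 0 = 0 by rewrite /total_benefit big_pred0.
  have x0 e : price 0 e = 0 by rewrite /price /run take0 ffunE.
  rewrite !tb0 mulr0 sub0r /potential !big1 ?oppr0 ?addr0 // => e _;
    by rewrite x0 ?mul0r ?mulr0.
pose i := Ordinal lej; have gs := run_good i.
rewrite -[j.+1]/(i.+1) !(total_benefit_succ _ i).
have {}IH : total_benefit rs Fopt i <=
    \sum_e price i e * (\sum_(k < i) Fopt k e)
    + (3 / 2 * total_benefit rs F i - potential (price i)) := IH (ltnW lej).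
have sum_le : \sum_e price i e * (\sum_(k < i) Fopt k e)
    + \sum_e price i e * Fopt i e
    <= \sum_e price i.+1 e * (\sum_(k < i.+1) Fopt k e).
  rewrite -big_split /=; apply: ler_sum => e _.
  rewrite big_ord_recr /= -mulrDr; apply: ler_wpM2r (step_mono gs e).
  rewrite addr_ge0 ?opt0 //; apply: sumr_ge0 => k _.
  exact: opt0 (ltn_trans (ltn_ord k) lej).
have opt_i0 : 0 <= \sum_e price i e * Fopt i e.
  apply: sumr_ge0 => e _; apply: mulr_ge0 (opt0 _ _ lej).
  exact: price_ge0 (ltnW lej).
have ALG_i : dual_slack (price i) (price i.+1) (req i) (F i) =
    3 / 2 * (if fully_serves F i then benefit (req i) else 0)
    - (potential (price i.+1) - potential (price i)) by [].
case: ifP => [/(served_benefit_le sol)|_].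
  lra.
have := step_slack gs; lra.
Qed.

(** Weak duality: the offline flow respects the capacities, so its total price is at most the
    potential and cancels against it. *)
Lemma ALG_competitive (Fopt : nat -> flow G) j :
  offline_solution rs Fopt -> (j <= size rs)%N ->
  total_benefit rs Fopt j <= 3 / 2 * total_benefit rs (ALG orc 2 2 rs j) j.
Proof.
move=> sol lej.
rewrite (@eq_total_benefit (ALG _ _ _ _ _) F); last first.
  by move=> k kj; rewrite ALG_prefix // kj.
apply: le_trans (offline_benefit_bound sol lej) _.
have [Fmf Faon Fload] := sol.
suff : \sum_e price j e * (\sum_(k < j) Fopt k e) <= potential (price j) by lra.
apply: ler_sum => e _; rewrite mulrC; apply: ler_wpM2r; first exact: price_ge0.
(* A prefix load is at most the final load because later offline flows are nonnegative. *)
apply: le_trans (Fload e); rewrite /load.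
rewrite -!(big_mkord xpredT (fun k => Fopt k e)) (big_cat_nat _ lej) //= lerDl.
rewrite big_nat; apply: sumr_ge0 => k /andP[_ kn].
by have [] := Fmf (Ordinal kn) kn.
Qed.

End Run.

(** * The logarithmic bound on the loads *)

Lemma card_edge_le (R : realType) (G : network R) :
  (#|edge G| <= #|vertex G| ^ 2)%N.
Proof.
rewrite -mulnn -(card_prod (vertex G) (vertex G)).
exact: leq_card (@edge_inj R G).
Qed.

Lemma scaled_powR_le (R : realType) (K K' a a' n : R) :
  1 <= n -> K <= K' -> 0 <= K' -> a <= a' -> K * n `^ a <= K' * n `^ a'.
Proof.
move=> n1 KK' K0 aa'; apply: (@le_trans _ _ (K' * n `^ a)).
  by rewrite ler_wpM2r ?powR_ge0.
by rewrite ler_wpM2l // ler_powR.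
Qed.

Section LoadBound.
Variables (R : realType) (K g : R).
Hypotheses (K1 : 1 <= K) (g0 : 0 <= g).

(** The result of [ln_le_of_powR_bound] for the bound [19 * K ^ 2 * n ^ (2 * g + 6)]; the leading 2
    appears because load is measured against [2 * cap e]. *)
Definition load_factor : R :=
  2 * ((ln (19 * K ^+ 2) / ln 2 + (2 * g + 6)) / ln 2).

Lemma load_factor_gt0 : 0 < load_factor.
Proof.
have ln2 : 0 < ln 2 :> R by apply: ln_gt0; lra.
have KK : 1 <= K ^+ 2 by rewrite exprn_ege1.
have lnK : 0 <= ln (19 * K ^+ 2) by apply: ln_ge0; lra.
have q0 : 0 <= ln (19 * K ^+ 2) / ln 2 by rewrite divr_ge0 // ltW.
rewrite /load_factor mulr_gt0 // divr_gt0 // ltr_wpDl //.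
by rewrite ltr_wpDl ?mulr_ge0.
Qed.

(** [load_price] and [price_bound] together bound an exponential in the relative load by a
    polynomial in [n], since [m] is at most [n ^ 2]; then logarithms are taken. *)
Lemma ALG_load_le (G : network R) (orc : oracle G) (rs : seq (request G)) j e :
  let n : R := #|vertex G|%:R in
  path_pruning_oracle (1 / (2 * #|edge G|%:R ^+ 2)) orc ->
  (forall e : edge G, 1 <= cap e <= K * n `^ g) ->
  (forall i : 'I_(size rs), 1 <= benefit (req i) <= K * n `^ g) ->
  (forall i : 'I_(size rs), 1 <= demand (req i)) -> (j <= size rs)%N ->
  load (ALG orc 2 2 rs j) j e <= load_factor * ln n * cap e.
Proof.
move=> n Horc capP benP dem1 lej.
have cap1 (e' : edge G) : 1 <= cap e' by case/andP: (capP e').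
have ben1 (i : 'I_(size rs)) : 1 <= benefit (req i) by case/andP: (benP i).
have ce := cap1 e; have lf0 := load_factor_gt0.
have [V1|V2] := leqP #|vertex G| 1.
  have lnn : 0 <= ln n.
    rewrite /n; case: #|vertex G| => [|k]; first by rewrite ln0.
    by rewrite ln_ge0 ?ler1n.
  rewrite (ALG_load_trivial Horc) //.
  by apply: mulr_ge0; [apply: mulr_ge0 => //; exact: ltW | lra].
have n2 : 2 <= n by rewrite ler_nat.
have n0 : 0 < n by lra.
set N := n `^ g in capP benP.
have N1 : 1 <= N by rewrite -[leLHS](powRr0 n) ler_powR //; lra.
have KN1 : 1 <= K * N by rewrite mulr_ege1.
set m : R := #|edge G|%:R in Horc.
have mn : m <= n ^+ 2 by rewrite -natrX ler_nat card_edge_le.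
have m0 : 0 <= m by rewrite ler0n.
set S := \sum_(e' : edge G) cap e'.
have S1 : 1 <= S.
  rewrite /S (bigD1 e) //= (le_trans ce) // lerDl; apply: sumr_ge0 => e' _.
  by have := cap1 e'; lra.
have SmKN : S <= m * (K * N).
  rewrite mulr_natl -sumr_const; apply: ler_sum => e' _.
  by case/andP: (capP e').
pose B := 8 * m ^+ 2 * (K * N) + 1.
have xB : xvar (foldl (step orc 2 2) (init_state G) (take j rs)) e <= B.
  apply: (price_bound Horc) => //; last lra.
  by move=> i; case/andP: (benP i).
have B1 : 1 <= B.
  by rewrite /B lerDr; apply: mulr_ge0; [rewrite mulr_ge0 ?sqr_ge0 | lra].
have := load_price Horc cap1 ben1 dem1 e lej.
rewrite -(load_ALG Horc) //.
set L := load _ _ _ / _ => HL.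
have {}HL : 2 `^ L <= 1 + 2 * S * B.
  have u0 : 0 < 1 / (2 * S) by rewrite divr_gt0 //; lra.
  rewrite -(ler_pM2l u0); apply: (le_trans HL).
  have -> : 1 / (2 * S) * (1 + 2 * S * B) = 1 / (2 * S) + B by field; lra.
  by rewrite addrC /unit_price -/S lerD2l.
have {}HL : 2 `^ L <= 19 * K ^+ 2 * n `^ (2 * g + 6).
  have -> : n `^ (2 * g + 6) = N ^+ 2 * n ^+ 6.
    rewrite powRD; last by apply/implyP => _; exact: lt0r_neq0.
    by rewrite [2 * g]mulrC powRrM powR_mulrn ?powR_ge0 // powR_mulrn // ltW.
  have -> : 19 * K ^+ 2 * (N ^+ 2 * n ^+ 6) = 19 * (K * N) ^+ 2 * n ^+ 6 by ring.
  apply: (le_trans HL).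
  set k := K * N in KN1 SmKN B xB B1 HL *.
  have nn1 : 1 <= n ^+ 2 by rewrite exprn_ege1 //; lra.
  have Sk : S <= n ^+ 2 * k.
    by apply: (le_trans SmKN); apply: ler_wpM2r => //; lra.
  have m2 : m ^+ 2 <= n ^+ 4 by rewrite (exprM n 2 2) ler_sqr ?nnegrE //; lra.
  have n4 : 1 <= n ^+ 4 by rewrite exprn_ege1 //; lra.
  have n4k : 1 <= n ^+ 4 * k by rewrite mulr_ege1.
  have Bk : B <= 9 * (n ^+ 4 * k).
    have : m ^+ 2 * k <= n ^+ 4 * k by apply: ler_wpM2r => //; lra.
    by rewrite /B -mulrA; lra.
  (* This gives [1 + 2 * S * B <= 1 + 18 * n ^ 6 * k ^ 2], and absorbing the 1 yields 19. *)
  have SB : S * B <= (n ^+ 2 * k) * (9 * (n ^+ 4 * k)) by apply: ler_pM; lra.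
  have SB1 : 1 <= (n ^+ 2 * k) * (n ^+ 4 * k).
    by apply: mulr_ege1 => //; apply: mulr_ege1.
  have -> : 19 * k ^+ 2 * n ^+ 6 = 19 * ((n ^+ 2 * k) * (n ^+ 4 * k)) by ring.
  lra.
have K2 : 1 <= 19 * K ^+ 2 by have : 1 <= K ^+ 2 by [rewrite exprn_ege1]; lra.
have g6 : 0 <= 2 * g + 6 by rewrite addr_ge0 ?mulr_ge0.
have := ln_le_of_powR_bound K2 g6 n2 HL.
rewrite /L ler_pdivrMr; last lra.
by move/le_trans; apply; rewrite /load_factor le_eqVlt; apply/orP; left;
  apply/eqP; ring.
Qed.

End LoadBound.

Theorem theorem1 (R : realType) (gamma Kb Kc : R) :
  exists Ka Kbeta : R, 0 < Ka /\ 0 < Kbeta /\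
  forall (G : network R) (orc : oracle G),
    let n : R := #|vertex G|%:R in
    let m : R := #|edge G|%:R in
    let eps : R := 1 / (2 * m ^+ 2) in
    path_pruning_oracle eps orc ->
    (forall e : edge G, 1 <= cap e <= Kc * n `^ gamma) ->
    let A := ALG orc 2 2 in
    online A /\
    forall rs : seq (request G),
      (forall i : 'I_(size rs), 1 <= benefit (req i) <= Kb * n `^ gamma) ->
      (forall i : 'I_(size rs), 1 <= demand (req i)) ->
      [/\ non_preemptive A rs,
          monotone A rs,
          forall j, (j <= size rs)%N ->
            multiflow rs (A rs j) j /\ all_or_nothing rs (A rs j) j
        & competitive A rs Ka (Kbeta * ln n)].
Proof.
(* One [K] dominates both constants; the maxima with 1 and 0 supply the signs that the logarithmic
   bound needs, as [gamma] may be negative. *)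
pose K := Num.max 1 (Num.max Kb Kc); pose g := Num.max gamma 0.
have K1 : 1 <= K by rewrite le_max lexx.
have KbK : Kb <= K by rewrite !le_max lexx orbT.
have KcK : Kc <= K by rewrite !le_max lexx !orbT.
have gg : gamma <= g by rewrite le_max lexx.
have g0 : 0 <= g by rewrite le_max lexx orbT.
have K0 : 0 <= K by lra.
exists (3 / 2), (load_factor K g); split; first lra.
split; first exact: load_factor_gt0.
move=> G orc n m eps Horc capP A; split.
  by move=> rs rs' j _ _ eq_take; rewrite /A /ALG eq_take.
move=> rs benP dem1.
have cap1 (e : edge G) : 1 <= cap e by case/andP: (capP e).
have ben1 (i : 'I_(size rs)) : 1 <= benefit (req i) by case/andP: (benP i).
have mon : monotone A rs by exact: (ALG_monotone Horc).
split=> //.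
- by move=> k i j e _ ij _; exact: mon.
- by move=> j lej; exact: (ALG_flow_spec Horc).
split=> [Fopt [sol _] j lej | j e lej].
  have := ALG_competitive Horc cap1 ben1 dem1 sol lej.
  by rewrite -/A; lra.
(* The edge [e] has an endpoint, so there is a vertex; powers of [n] are then monotone in the
   exponent. *)
have n1 : 1 <= n by rewrite ler1n; apply/card_gt0P; exists (esrc e).
have le_Kg c : c <= K -> c * n `^ gamma <= K * n `^ g.
  by move=> cK; apply: scaled_powR_le.
apply: (ALG_load_le K1 g0 _ Horc) => // [e'|i].
  by case/andP: (capP e') => -> /le_trans -> //; exact: le_Kg.
by case/andP: (benP i) => -> /le_trans -> //; exact: le_Kg.
Qed.
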